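(* Let $d\geq 1$ and $m\geq 1$. Let $P$ be a finite family of points in $\mathbb{R}^d$ colored with $d+m$ colors, such that the convex hull of every color class contains the origin. Then there is a colorful set $\{u_1,\ldots,u_d,v_1,\ldots,v_m\}\subset P$ such that $0\in \operatorname{conv}(\{u_1,\ldots,u_d,v_i\})$ for all $i\in\{1,\ldots,m\}$.
   Context: A family colored with $d+m$ colors is partitioned into $d+m$ color classes; a subfamily is colorful if it contains at least one member from each color class (here, since it has $d+m$ members, exactly one from each). $\operatorname{conv}$ denotes the convex hull. *)

(* Defs.v *)
From mathcomp Require Import all_boot all_order all_algebra.
From mathcomp Require Import all_classical all_reals.
From mathcomp Require Import convex.

Set Implicit Arguments.
Unset Strict Implicit.
Unset Printing Implicit Defensive.

Import Order.TTheory GRing.Theory Num.Theory.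

Local Open Scope classical_set_scope.
Local Open Scope ring_scope.

Definition conv_hull (R : realType) (E : lmodType R) (A : set E) : set E :=
  smallest (@convex_set R E) A.

(** Families are indexed by a finite type [I], so that a point may occur several
    times, with equal or different colors; subfamilies are sets of indices. *)
Definition color_class (I : finType) (k : nat) (c : I -> 'I_k) (j : 'I_k) :
  {set I} := [set i | c i == j]%SET.

Definition colorful (I : finType) (k : nat) (c : I -> 'I_k) (S : {set I}) :
  Prop := forall j : 'I_k, exists2 i, i \in S & i \in color_class c j.

(* Main.v *)
(** Among all [d]-tuples [u] of points with pairwise distinct colors, choose one
    whose convex hull is nearest to the origin, and let [y] be the nearest
    point. If [y = 0], any completion works. Otherwise every other color
    contains some [x] with [<x, y> <= 0], and any such [x] works. Indeed
    all weights of [y] are positive and all [u_k] lie on the hyperplane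
    [<., y> = |y|^2] (as in Barany's argument, a point of weight zero could be
    exchanged for a nearer one of the same color). The [d + 1] vectors
    [u_1, ..., u_d, x] satisfy a linear relation in which the coefficient of [x]
    is nonnegative; if all coefficients are nonnegative, then
    [0] is in the convex hull of [u_1, ..., u_d, x]. If not, adding a multiple of
    the relation to [y] exchanges some [u_k] for [x] and expresses [y] with
    nonnegative weights of sum at least [1]; sum [> 1] gives a nearer hull, while
    sum [1] gives [y] again with a zero weight. Both are impossible. *)

Require Import Defs.
From mathcomp Require Import all_boot all_order all_algebra.
From mathcomp Require Import all_classical all_reals.
From mathcomp Require Import interval_inference topology normedtype derive.
From mathcomp Require Import convex.
From mathcomp Require Import ring lra.

Set Implicit Arguments.
Unset Strict Implicit.
Unset Printing Implicit Defensive.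

Import Order.TTheory GRing.Theory Num.Theory.
Import numFieldNormedType.Exports.

Local Open Scope classical_set_scope.
Local Open Scope ring_scope.

(** * Convex hulls *)

Lemma conv_hull_convex (R : realType) (E : lmodType R) (A : set E) (x y : E) (t : R) :
  0 <= t <= 1 -> conv_hull A x -> conv_hull A y ->
  conv_hull A (t *: x + (1 - t) *: y).
Proof.
move=> /andP[t0 t1] Ax Ay K [Kc AK].
pose l : {i01 R} := Itv01 t0 t1.
have := Kc x y l; rewrite !inE; apply; [exact: Ax|exact: Ay].
Qed.

Lemma convex_setP (R : realType) (E : lmodType R) (K : set E) :
  (forall x y t, 0 <= t <= 1 -> K x -> K y -> K (t *: x + (1 - t) *: y)) ->
  @convex_set R E K.
Proof.
move=> H x y l; rewrite !inE => Kx Ky.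
by apply: (H x y l%:num) => //; apply/andP; split.
Qed.

(** Induction on [s]: the head is split off with weight [w a] and the tail rescaled by
    [(1 - w a)^-1]. If [w a = 1], all tail weights vanish instead. *)
Lemma conv_hull_sum (R : realType) (E : lmodType R) (A : set E) (J : eqType)
    (s : seq J) (w : J -> R) (f : J -> E) :
  (forall j, 0 <= w j) -> (forall j, A (f j)) -> \sum_(j <- s) w j = 1 ->
  conv_hull A (\sum_(j <- s) w j *: f j).
Proof.
move=> + Af; elim: s w => [|a s IHs] w w0.
  by rewrite big_nil => /eqP; rewrite eq_sym oner_eq0.
rewrite !big_cons => ws.
have fA j : conv_hull A (f j) by move=> K [_]; apply.
have s0 : 0 <= \sum_(j <- s) w j by exact: sumr_ge0.
have [wa1|wa1] := eqVneq (w a) 1.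
  have : \sum_(j <- s) w j == 0 by lra.
  rewrite psumr_eq0// => /allP ws0.
  rewrite big_seq big1 => [|j /ws0/eqP ->]; last by rewrite scale0r.
  by rewrite wa1 scale1r addr0.
have wa : 0 <= w a <= 1 by rewrite w0 /=; lra.
have wa' : 1 - w a != 0 by rewrite subr_eq0 eq_sym.
rewrite (_ : \sum_(j <- s) _ =
    (1 - w a) *: \sum_(j <- s) ((1 - w a)^-1 * w j) *: f j); last first.
  by rewrite scaler_sumr; apply: eq_bigr => j _; rewrite scalerA mulVKf.
apply: conv_hull_convex => //; apply: IHs.
  by move=> j; rewrite mulr_ge0// invr_ge0; lra.
rewrite -mulr_sumr (_ : \sum_(j <- s) w j = 1 - w a) ?mulVf//; lra.
Qed.

(** * The scalar product and nearest points *)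

Definition dot (R : realType) (n : nat) (a b : 'rV[R]_n) : R :=
  \sum_j a 0 j * b 0 j.

Lemma dotC (R : realType) (n : nat) (a b : 'rV[R]_n) : dot a b = dot b a.
Proof. by apply: eq_bigr => j _; rewrite mulrC. Qed.

Lemma dotDl (R : realType) (n : nat) (a b c : 'rV[R]_n) :
  dot (a + b) c = dot a c + dot b c.
Proof. by rewrite -big_split; apply: eq_bigr => j _; rewrite mxE mulrDl. Qed.

Lemma dotZl (R : realType) (n : nat) (t : R) (a b : 'rV[R]_n) :
  dot (t *: a) b = t * dot a b.
Proof. by rewrite mulr_sumr; apply: eq_bigr => j _; rewrite mxE mulrA. Qed.

Lemma dotDr (R : realType) (n : nat) (a b c : 'rV[R]_n) :
  dot a (b + c) = dot a b + dot a c.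
Proof. by rewrite !(dotC a) dotDl. Qed.

Lemma dotZr (R : realType) (n : nat) (t : R) (a b : 'rV[R]_n) :
  dot a (t *: b) = t * dot a b.
Proof. by rewrite !(dotC a) dotZl. Qed.

Lemma dot0l (R : realType) (n : nat) (a : 'rV[R]_n) : dot 0 a = 0.
Proof. by rewrite -(scale0r 0) dotZl mul0r. Qed.

Lemma dot_suml (R : realType) (n : nat) (J : finType) (f : J -> 'rV[R]_n)
    (b : 'rV[R]_n) :
  dot (\sum_j f j) b = \sum_j dot (f j) b.
Proof.
exact: (big_morph (fun x => dot x b) (fun x y => dotDl x y b) (dot0l b)).
Qed.

Lemma dot_ge0 (R : realType) (n : nat) (a : 'rV[R]_n) : 0 <= dot a a.
Proof. by apply: sumr_ge0 => j _; rewrite -expr2 sqr_ge0. Qed.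

Lemma dot_eq0 (R : realType) (n : nat) (a : 'rV[R]_n) : dot a a = 0 -> a = 0.
Proof.
move=> /eqP; rewrite psumr_eq0 => [/allP a0|j _]; last by rewrite -expr2 sqr_ge0.
apply/rowP => j; rewrite mxE; apply/eqP.
by have := a0 j (mem_index_enum j); rewrite -expr2 sqrf_eq0.
Qed.

Lemma dot_gt0 (R : realType) (n : nat) (a : 'rV[R]_n) : a != 0 -> 0 < dot a a.
Proof.
by move=> a0; rewrite lt_def dot_ge0 andbT; apply: contra_neq a0 => /dot_eq0.
Qed.

(** Otherwise the open half-space [0 < dot z y] is a convex set containing [A], hence containing
    [0], which is absurd. *)
Lemma conv_hull_dot_le0 (R : realType) (n : nat) (A : set 'rV[R]_n)
    (y : 'rV[R]_n) :
  conv_hull A 0 -> exists2 a, A a & dot a y <= 0.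
Proof.
move=> A0; apply: contrapT => /forall2NP H.
suff : [set z | 0 < dot z y] 0 by rewrite /= dot0l ltxx.
apply: A0; split=> [|a Aa] /=; last by have [//|/negP] := H a; rewrite -ltNge.
apply: convex_setP => x z t /andP[t0 t1] /=; rewrite dotDl !dotZl => x0 z0.
by have [->|tn0] := eqVneq t 0; nra.
Qed.

(** The variational inequality of the nearest point [y] in a convex set. *)
Lemma dot_ge_of_segment_min (R : realType) (n : nat) (x y : 'rV[R]_n) :
  (forall t, 0 <= t <= 1 ->
    dot y y <= dot ((1 - t) *: y + t *: x) ((1 - t) *: y + t *: x)) ->
  dot y y <= dot x y.
Proof.
move=> H; rewrite leNgt; apply/negP => xy.
have Q0 := dot_ge0 (x - y).
set N := dot y y in H xy *; set a := dot x y in xy *; set Q := dot _ _ in Q0.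
have D0 : 0 < N - a + Q by lra.
(* The squared norm along the segment is [N - 2 * t * (N - a) + t ^+ 2 * Q]. Its minimizer would be
   [(N - a) / Q]; the extra [N - a] in the denominator keeps [t] at most [1], and the value still
   drops below [N]. *)
pose t := (N - a) / (N - a + Q).
have t01 : 0 <= t <= 1 by rewrite divr_ge0 ?ler_pdivrMr ?mul1r//=; lra.
have {H} := H _ t01.
have tE : t * (N - a + Q) = N - a by rewrite divfK// gt_eqF.
have t0 : 0 < t by rewrite divr_gt0//; lra.
have QE : Q = dot x x - 2 * a + N.
  by rewrite /Q -scaleN1r !(dotDl, dotDr, dotZl, dotZr) (dotC y x) -/a -/N; ring.
rewrite !(dotDl, dotDr, dotZl, dotZr) (dotC y x) -/a -/N.
have -> : dot x x = Q + 2 * a - N by lra.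
nra.
Qed.

(** * Convex combinations and compactness of the simplex *)

Definition simplex (R : realType) (n : nat) : set 'rV[R]_n :=
  [set w | (forall k, 0 <= w 0 k) /\ \sum_k w 0 k = 1].

Definition comb (R : realType) (n d : nat) (w : 'rV[R]_n)
  (f : 'I_n -> 'rV[R]_d) : 'rV[R]_d := \sum_k w 0 k *: f k.

Lemma continuous_sumr (R : realType) (T : topologicalType) (J : finType)
    (F : J -> T -> R) :
  (forall j, continuous (F j)) -> continuous (fun x => \sum_j F j x).
Proof.
move=> Fc; apply: (@continuous_big R J +%R 0 xpredT _ T) => //.
exact: add_continuous.
Qed.

Lemma continuous_coord_sum (R : realType) (n : nat) (a : 'I_n -> R) :
  continuous (fun w : 'rV[R]_n => \sum_k w 0 k * a k).
Proof.
apply: continuous_sumr => k w.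
by apply: (@continuousM _ _ (fun v : 'rV[R]_n => v 0 k) (cst (a k)));
  [exact: coord_continuous|exact: cst_continuous].
Qed.

Lemma simplex_compact (R : realType) (n : nat) : compact (@simplex R n).
Proof.
pose box := [set v : 'rV[R]_n | forall i, v ord0 i \in `[0 : R, 1]].
have boxc : compact box.
  by apply: (@rV_compact R n (fun=> `[0, 1]%classic)) => _; exact: segment_compact.
apply: (subclosed_compact _ boxc) => [|w [w0 w1] i]; last first.
  rewrite in_itv /= w0 -w1 (bigD1 i)//= lerDl.
  by apply: sumr_ge0 => j _; exact: w0.
(* An intersection of closed half-spaces and a closed hyperplane; the factor [1] gives the sum the
   shape of [continuous_coord_sum]. *)
have -> : @simplex R n =
    (\bigcap_k [set w : 'rV[R]_n | 0 <= w 0 k]) `&`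
    [set w | \sum_k w 0 k * 1 = 1].
  apply/seteqP; split=> w [w0 w1]; split.
  - by move=> k _; exact: w0.
  - by rewrite /= -mulr_suml mulr1.
  - by move=> k; exact: w0.
  - by move: w1; rewrite /= -mulr_suml mulr1.
apply: closedI.
  apply: closed_bigI => k _.
  apply: (@preimage_closed _ _ (fun v : 'rV[R]_n => v 0 k) [set x | 0 <= x]).
    by move=> w _; exact: coord_continuous.
  exact: closed_ge.
apply: (@preimage_closed _ _ (fun v : 'rV[R]_n => \sum_k v 0 k * 1) [set x | x = 1]).
  by move=> w _; exact: continuous_coord_sum.
exact: closed_eq.
Qed.

(** A continuous function attains its minimum on the compact simplex, which is nonempty because
    there are [n.+1] coordinates. *)
Lemma exists_nearest_comb (R : realType) (n d : nat) (f : 'I_n.+1 -> 'rV[R]_d) :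
  exists2 w, simplex w & forall w', simplex w' ->
    dot (comb w f) (comb w f) <= dot (comb w' f) (comb w' f).
Proof.
pose F (w : 'rV[R]_n.+1) := dot (comb w f) (comb w f).
have F_cont : continuous F.
  apply: continuous_sumr => j w.
  have combE : (fun v : 'rV[R]_n.+1 => comb v f 0 j) =
      (fun v => \sum_k v 0 k * f k 0 j).
    by apply/funext => v; rewrite summxE; apply: eq_bigr => k _; rewrite mxE.
  by apply: continuousM; rewrite combE; exact: continuous_coord_sum.
have [] := @EVT_min_rV R n.+1 F (@simplex R n.+1) _ (@simplex_compact R n.+1) _.
- exists (delta_mx 0 0); split=> [k|]; first by rewrite mxE /=; case: eqP.
  rewrite (bigD1 0)//= mxE !eqxx big1 ?addr0// => k /negbTE k0.
  by rewrite mxE k0 andbF.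
- exact: continuous_subspaceT.
move=> w; rewrite inE => sw Hw; exists w => // w' sw'.
by apply: Hw; rewrite inE.
Qed.

(** * Rainbow tuples whose hull is nearest to the origin *)

(** Tuple and weights compete jointly, so that exchanging a point and reweighting can be compared
    with the optimum in one step. *)
Definition shortest (R : realType) (n d : nat) (I : finType) (C : eqType)
    (p : I -> 'rV[R]_d) (c : I -> C) (u : 'I_n -> I) (w : 'rV[R]_n) : Prop :=
  [/\ injective (c \o u), simplex w &
    forall (u' : 'I_n -> I) (w' : 'rV[R]_n),
      injective (c \o u') -> simplex w' ->
      dot (comb w (p \o u)) (comb w (p \o u)) <=
      dot (comb w' (p \o u')) (comb w' (p \o u'))].

(** Optimal weights are chosen for each tuple first; the best tuple is then taken among the finitely
    many rainbow ones, encoded as finite functions. *)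
Lemma exists_shortest (R : realType) (n d : nat) (I : finType) (C : eqType)
    (p : I -> 'rV[R]_d) (c : I -> C) (u0 : 'I_n.+1 -> I) :
  injective (c \o u0) -> exists u w, @shortest R n.+1 d I C p c u w.
Proof.
move=> u0_inj.
have /choice[W HW] (u : {ffun 'I_n.+1 -> I}) : exists w, simplex w /\
    forall w', simplex w' ->
      dot (comb w (p \o u)) (comb w (p \o u)) <=
      dot (comb w' (p \o u)) (comb w' (p \o u)).
  by have [w] := exists_nearest_comb (p \o u); exists w.
pose F (u : {ffun 'I_n.+1 -> I}) :=
  dot (comb (W u) (p \o u)) (comb (W u) (p \o u)).
have ffunK (u : 'I_n.+1 -> I) : finfun u = u :> (_ -> _).
  by apply/funext => k; rewrite ffunE.
have u0P : injectiveb (c \o finfun u0) by apply/injectiveP; rewrite ffunK.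
pose rainbow (u : {ffun 'I_n.+1 -> I}) := injectiveb (c \o u).
case: (arg_minP (P := rainbow) F u0P) => u /injectiveP cu u_min.
exists u, (W u); split=> // [|u' w' cu' sw']; first by have [] := HW u.
rewrite -(ffunK u'); apply: (le_trans (u_min (finfun u') _)).
  by apply/injectiveP; rewrite ffunK.
by have [_] := HW (finfun u'); apply.
Qed.

Definition upd (n : nat) (T : Type) (u : 'I_n -> T) (k : 'I_n) (x : T) :
  'I_n -> T := fun l => if l == k then x else u l.

Lemma upd_inj (n : nat) (I : Type) (C : eqType) (c : I -> C) (u : 'I_n -> I)
    (k : 'I_n) (i : I) :
  injective (c \o u) -> (forall l, l != k -> c (u l) != c i) ->
  injective (c \o upd u k i).
Proof.
move=> cu ci l l' /=; rewrite /upd.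
case: eqVneq => [->|lk]; case: eqVneq => [->|l'k] //.
- by move=> e; have := ci _ l'k; rewrite e eqxx.
- by move=> e; have := ci _ lk; rewrite e eqxx.
- exact: cu.
Qed.

Lemma comb_upd (R : realType) (n d : nat) (I : Type) (p : I -> 'rV[R]_d)
    (u : 'I_n -> I) (w : 'rV[R]_n) (k : 'I_n) (i : I) :
  comb w (p \o upd u k i) = comb w (p \o u) + w 0 k *: (p i - p (u k)).
Proof.
rewrite /comb (bigD1 k)//= [in RHS](bigD1 k)//= /upd eqxx scalerBr.
rewrite addrAC [X in _ = X + _]addrCA subrr addr0; congr (_ + _).
by apply: eq_bigr => l /negbTE ->.
Qed.

(** Moving the weights towards the vertex [delta_mx 0 k] stays in the simplex, so the segment from
    the nearest point to [p (u k)] never gets closer to the origin. *)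
Lemma shortest_ge (R : realType) (n d : nat) (I : finType) (C : eqType)
    (p : I -> 'rV[R]_d) (c : I -> C) (u : 'I_n -> I) (w : 'rV[R]_n) (k : 'I_n) :
  shortest p c u w ->
  dot (comb w (p \o u)) (comb w (p \o u)) <= dot (p (u k)) (comb w (p \o u)).
Proof.
move=> [cu [w0 w1] uw_min]; apply: dot_ge_of_segment_min => t /andP[t0 t1].
have -> : (1 - t) *: comb w (p \o u) + t *: p (u k) =
    comb ((1 - t) *: w + t *: delta_mx 0 k) (p \o u).
  rewrite /comb scaler_sumr (bigD1 k)//= [RHS](bigD1 k)//= addrAC !mxE !eqxx.
  rewrite mulr1 scalerA -scalerDl; congr (_ + _).
  by apply: eq_bigr => l /negbTE lk; rewrite !mxE lk andbF mulr0 addr0 scalerA.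
apply: uw_min => //; split=> [l|].
  by rewrite !mxE; have := w0 l; case: (_ && _) => /=; nra.
rewrite (eq_bigr (fun l => (1 - t) * w 0 l + t * (l == k)%:R)); last first.
  by move=> l _; rewrite !mxE eqxx.
rewrite big_split/= -!mulr_sumr w1 (bigD1 k)//= eqxx big1 ?addr0/=; first by ring.
by move=> l /negbTE ->.
Qed.

Lemma shortest_weight_gt0 (R : realType) (n d : nat) (I : finType) (C : eqType)
    (p : I -> 'rV[R]_d) (c : I -> C) (u : 'I_n -> I) (w : 'rV[R]_n) (k : 'I_n) :
  (forall j y, exists2 i, c i = j & dot (p i) y <= 0) ->
  shortest p c u w -> comb w (p \o u) != 0 -> 0 < w 0 k.
Proof.
move=> hx uw; have [cu sw uw_min] := uw; have [w0 _] := sw => y0.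
rewrite lt_def w0 andbT; apply/negP => /eqP wk.
(* If [w 0 k] vanished, replacing [u k] by [i] of the same color would keep the nearest point [y],
   and [shortest_ge] at [i] would give [dot y y <= dot (p i) y <= 0]. *)
have [i ci ile] := hx (c (u k)) (comb w (p \o u)).
have yE : comb w (p \o upd u k i) = comb w (p \o u).
  by rewrite comb_upd wk scale0r addr0.
have /shortest_ge : shortest p c (upd u k i) w.
  split=> //; last by rewrite yE.
  apply: upd_inj => // l; apply: contraNneq; rewrite ci => e; exact/eqP/cu.
move=> /(_ k); rewrite yE /upd eqxx leNgt => /negP; apply.
by rewrite (le_lt_trans ile)// dot_gt0.
Qed.

(** With [y] the nearest point, the [w]-mean of the products [dot (p (u l)) y] is [dot y y], and
    none is smaller; a positive weight at [k] forces equality there. *)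
Lemma shortest_dot (R : realType) (n d : nat) (I : finType) (C : eqType)
    (p : I -> 'rV[R]_d) (c : I -> C) (u : 'I_n -> I) (w : 'rV[R]_n) (k : 'I_n) :
  (forall j y, exists2 i, c i = j & dot (p i) y <= 0) ->
  shortest p c u w -> comb w (p \o u) != 0 ->
  dot (p (u k)) (comb w (p \o u)) = dot (comb w (p \o u)) (comb w (p \o u)).
Proof.
move=> hx uw y0; have [_ [w0 w1] _] := uw; have wk := shortest_weight_gt0 k hx uw y0.
set y := comb w (p \o u); pose e l := w 0 l * (dot (p (u l)) y - dot y y).
have e0 l : 0 <= e l by rewrite mulr_ge0// subr_ge0 (shortest_ge l uw).
have : \sum_l e l == 0.
  rewrite (eq_bigr (fun l => w 0 l * dot (p (u l)) y - w 0 l * dot y y)).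
    rewrite sumrB -mulr_suml w1 mul1r subr_eq0 {2}/y dot_suml; apply/eqP.
    by apply: eq_bigr => l _; rewrite dotZl.
  by move=> l _; rewrite /e mulrBr.
rewrite psumr_eq0// => /allP/(_ k (mem_index_enum k))/=.
by rewrite mulf_eq0 (gt_eqF wk) subr_eq0 => /eqP.
Qed.

(** * Linear dependencies and their signs *)

Lemma exists_dependency (R : realType) (d : nat) (f : 'I_d -> 'rV[R]_d)
    (x : 'rV[R]_d) :
  exists (a : 'I_d -> R) (b : R),
    [/\ 0 <= b, b != 0 \/ exists k, a k != 0 &
        \sum_k a k *: f k + b *: x = 0].
Proof.
(* Row [0] is [x] and the others are the [f k]: with [d.+1] rows and [d] columns, the left kernel is
   nonzero. *)
pose M := \matrix_o (if unlift ord0 o is Some k then f k else x) : 'M[R]_(d.+1, d).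
have /rowV0Pn[v /sub_kermxP vM v0] : kermx M != 0.
  rewrite kermx_eq0 /row_free; apply: contraL (rank_leq_col M) => /eqP ->.
  by rewrite -ltnNge.
have {}vM : v 0 ord0 *: x + \sum_k v 0 (lift ord0 k) *: f k = 0.
  rewrite -[RHS]vM mulmx_sum_row big_ord_recl rowK unlift_none; congr (_ + _).
  by apply: eq_bigr => k _; rewrite rowK liftK.
have [o vo] : exists o, v 0 o != 0.
  by apply/existsP; apply: contraR v0 => /existsPn H; apply/eqP/rowP => o;
    have /negPn/eqP -> := H o; rewrite mxE.
(* A sign [s] that makes the coefficient of [x] nonnegative. *)
have [s [s0 sv]] : exists s : R, s != 0 /\ 0 <= s * v 0 ord0.
  have [v0p|v0n] := leP 0 (v 0 ord0); first by exists 1; rewrite mul1r oner_neq0.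
  by exists (-1); rewrite mulN1r oppr_ge0 ltW// oppr_eq0 oner_neq0.
exists (fun k => s * v 0 (lift ord0 k)), (s * v 0 ord0); split=> //.
  case: (unliftP ord0 o) vo => [k ->|->] vo; [right; exists k|left];
    by rewrite mulf_neq0.
rewrite (eq_bigr (fun k => s *: (v 0 (lift ord0 k) *: f k))).
  by rewrite -scalerA -scaler_sumr -scalerDr addrC vM scaler0.
by move=> k _; rewrite scalerA.
Qed.

Lemma combD (R : realType) (n d : nat) (v w : 'rV[R]_n) (f : 'I_n -> 'rV[R]_d) :
  comb (v + w) f = comb v f + comb w f.
Proof.
by rewrite /comb -big_split; apply: eq_bigr => k _; rewrite mxE scalerDl.
Qed.

Lemma combZ (R : realType) (n d : nat) (t : R) (w : 'rV[R]_n)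
    (f : 'I_n -> 'rV[R]_d) :
  comb (t *: w) f = t *: comb w f.
Proof.
by rewrite /comb scaler_sumr; apply: eq_bigr => k _; rewrite mxE scalerA.
Qed.

Lemma comb_delta (R : realType) (n d : nat) (k : 'I_n) (f : 'I_n -> 'rV[R]_d) :
  comb (delta_mx 0 k) f = f k.
Proof.
rewrite /comb (bigD1 k)//= mxE !eqxx scale1r big1 ?addr0// => l /negbTE lk.
by rewrite mxE lk andbF scale0r.
Qed.

Lemma conv_hull_nonneg_dependency (R : realType) (n : nat) (E : lmodType R)
    (f : 'I_n -> E) (x : E) (a : 'I_n -> R) (b : R) :
  (forall k, 0 <= a k) -> 0 <= b -> b != 0 \/ (exists k, a k != 0) ->
  \sum_k a k *: f k + b *: x = 0 -> conv_hull (range f `|` [set x]) 0.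
Proof.
move=> a0 b0 ab dep.
have s0 : 0 <= \sum_k a k by exact: sumr_ge0.
(* Dividing by the positive total [S] turns the relation into a convex combination. *)
pose S := b + \sum_k a k.
have S0 : 0 < S.
  case: ab => [bn0|[k ak]].
    by rewrite ltr_wpDr// lt_def bn0.
  have akp : 0 < a k by rewrite lt_def ak a0.
  by rewrite ltr_wpDl// (bigD1 k)//= ltr_wpDr// sumr_ge0.
pose A j := if unlift ord0 j is Some k then a k else b.
pose g j := if unlift ord0 j is Some k then f k else x.
have -> : 0 = \sum_(j < n.+1) (S^-1 * A j) *: g j.
  rewrite (eq_bigr (fun j => S^-1 *: (A j *: g j))); last first.
    by move=> j _; rewrite scalerA.
  rewrite -scaler_sumr big_ord_recl /A /g unlift_none.
  under eq_bigr do rewrite liftK.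
  by rewrite addrC dep scaler0.
apply: conv_hull_sum => [j|j|].
- by rewrite mulr_ge0// ?invr_ge0 ?(ltW S0)// /A; case: (unlift ord0 j).
- by rewrite /g; case: (unlift ord0 j) => [l|]; [left; exists l|right].
- rewrite -mulr_sumr big_ord_recl /A unlift_none.
  under eq_bigr do rewrite liftK.
  by rewrite mulVf// gt_eqF.
Qed.

(** The pivot rule of the simplex method: [s] grows until the first weight reaches zero, at the
    least ratio [w k / - a k] with [a k < 0]. *)
Lemma ratio_test (R : realType) (n : nat) (w a : 'I_n -> R) (k0 : 'I_n) :
  (forall k, 0 < w k) -> a k0 < 0 ->
  exists k s, [/\ 0 < s, w k + s * a k = 0 & forall l, 0 <= w l + s * a l].
Proof.
move=> w0 ak0.
case: (arg_minP (P := fun k => a k < 0) (fun k => w k / - a k) ak0) => k ak k_min.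
exists k, (w k / - a k); split.
- by rewrite divr_gt0// oppr_gt0.
- by field; rewrite lt_eqF.
move=> l; have [al|al] := leP 0 (a l).
  by rewrite addr_ge0 ?(ltW (w0 l))// mulr_ge0// ltW// divr_gt0// oppr_gt0.
have := k_min l al; rewrite ler_pdivlMr ?oppr_gt0//; lra.
Qed.

(** * The exchange argument *)

Lemma shortest_conv_hull (R : realType) (d : nat) (I : finType) (C : eqType)
    (p : I -> 'rV[R]_d) (c : I -> C) (u : 'I_d -> I) (w : 'rV[R]_d) (i : I) :
  (forall j y, exists2 i, c i = j & dot (p i) y <= 0) ->
  shortest p c u w -> comb w (p \o u) != 0 ->
  (forall l, c (u l) != c i) -> dot (p i) (comb w (p \o u)) <= 0 ->
  conv_hull (range (p \o u) `|` [set p i]) 0.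
Proof.
move=> hx uw; have [cu [_ w1] uw_min] := uw.
have w_gt0 k := shortest_weight_gt0 k hx uw.
have uwE k := shortest_dot k hx uw.
set y := comb w (p \o u) in w_gt0 uwE uw_min * => y0 ci iy.
have [a [b [b0 ab0 dep]]] := exists_dependency (p \o u) (p i).
have [a_ge0|] := pselect (forall k, 0 <= a k).
  exact: conv_hull_nonneg_dependency dep.
move=> /existsNP[k0 /negP]; rewrite -ltNge => ak0; exfalso.
have N0 := dot_gt0 y0.
have [k [s [s0 wk wl]]] := ratio_test (fun k => w_gt0 k y0) ak0.
(* Pairing the dependency with [y] gives [(\sum_l a l) * dot y y + b * dot (p i) y = 0], whose
   second term is at most [0]. *)
have a_sum : 0 <= \sum_l a l.
  have : dot (\sum_l a l *: (p \o u) l + b *: p i) y = 0 by rewrite dep dot0l.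
  rewrite dotDl dot_suml (eq_bigr (fun l => a l * dot y y)); last first.
    by move=> l _; rewrite dotZl /= uwE.
  by rewrite -mulr_suml dotZl => e; nra.
(* The weights [w + s a] on [u] and [s b] on [p i] represent [y], and the former
   vanish at [k], so [p i] may take the place of [u k]. *)
pose W := w + s *: (\row_l a l) + (s * b) *: delta_mx 0 k.
have Wk : W 0 k = s * b.
  by rewrite /W !mxE !eqxx /= wk add0r mulr1.
have W_ge0 l : 0 <= W 0 l.
  rewrite /W !mxE addr_ge0// mulr_ge0// mulr_ge0//; exact: ltW.
have WT : \sum_l W 0 l = 1 + s * \sum_l a l + s * b.
  rewrite (eq_bigr (fun l => w 0 l + s * a l + s * b * (l == k)%:R)); last first.
    by move=> l _; rewrite /W !mxE eqxx.
  rewrite !big_split /= w1 -!mulr_sumr; congr (_ + _).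
  rewrite (bigD1 k)//= eqxx big1 ?addr0 ?mulr1//.
  by move=> l /negbTE ->.
have Wy : comb W (p \o upd u k i) = y.
  rewrite comb_upd Wk !combD !combZ comb_delta -/y /=.
  have -> : comb (\row_l a l) (p \o u) = - (b *: p i).
    apply/eqP; rewrite -addr_eq0 -dep; apply/eqP; congr (_ + _).
    by apply: eq_bigr => l _; rewrite mxE.
  rewrite scalerN scalerBr !scalerA [X in _ + X]addrC addrA.
  by rewrite -[_ - _ + _ - _]addrA subrr addr0 subrK.
have cu' : injective (c \o upd u k i) by apply: upd_inj => // l _; exact: ci.
set T := \sum_l W 0 l in WT; have sb0 : 0 <= s * b by rewrite mulr_ge0// ltW.
have sa0 : 0 <= s * \sum_l a l by rewrite mulr_ge0// ltW.
have T0 : 0 < T by lra.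
(* The normalized weights represent [T^-1 *: y], which would be shorter than [y] if [T] exceeded
   [1]. *)
have T1 : T <= 1.
  have sW : simplex (T^-1 *: W).
    split=> [l|]; first by rewrite mxE mulr_ge0// invr_ge0 ltW.
    under eq_bigr do rewrite mxE.
    by rewrite -mulr_sumr mulVf// gt_eqF.
  have := uw_min _ _ cu' sW; rewrite combZ Wy dotZl dotZr mulrA.
  rewrite -[X in X <= _]mul1r ler_pM2r// -expr2.
  rewrite leNgt => H; rewrite leNgt; apply: contra H => T1.
  by rewrite expr_lt1 ?invr_ge0 ?invf_lt1// ltW.
(* Since [T = 1 + s * \sum_l a l + s * b] with nonnegative summands, [T <= 1] leaves no slack. The
   exchanged tuple is then shortest with weight zero at [k], against [shortest_weight_gt0]. *)
have sb : s * b = 0 by lra.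
have : shortest p c (upd u k i) W.
  split=> //; first by split=> //; rewrite -/T; lra.
  by rewrite Wy.
by move=> /(shortest_weight_gt0 k hx); rewrite Wy Wk sb ltxx => /(_ y0).
Qed.

(** * Completion to a colorful set *)

Theorem theorem6p2 (R : realType) (d m : nat) (hd : (1 <= d)%N) (hm : (1 <= m)%N)
    (I : finType) (p : I -> 'rV[R]_d) (c : I -> 'I_(d + m))
    (hc : forall j : 'I_(d + m),
      conv_hull (p @` [set` color_class c j]) 0) :
  exists (u : 'I_d -> I) (v : 'I_m -> I),
    colorful c ([set u k | k : 'I_d] :|: [set v i | i : 'I_m])%SET /\
    forall i : 'I_m, conv_hull (range (p \o u) `|` [set p (v i)]) 0.
Proof.
have hx j y : exists2 i, c i = j & dot (p i) y <= 0.
  have [_ [i /= ij <-] iy] := conv_hull_dot_le0 y (hc j); exists i => //.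
  by apply/eqP; move: ij; rewrite inE.
have [u [w uw]] : exists u w, @shortest R d d I _ p c u w.
  (* The minimization starts from one point of each of the first [d] colors. *)
  case: d hd p c hc hx => // d _ p c _ hx.
  have /choice[u0 cu0] (k : 'I_d.+1) : exists i, c i = lshift m k.
    by have [i] := hx (lshift m k) 0; exists i.
  apply: (@exists_shortest R d d.+1 I _ p c u0) => k l /=.
  by rewrite !cu0 => /lshift_inj.
have [cu sw _] := uw.
have /choice[x Hx] (j : 'I_(d + m)) : exists i, c i = j /\
    ((forall l, c (u l) != j) -> conv_hull (range (p \o u) `|` [set p i]) 0).
  have [i ci iy] := hx j (comb w (p \o u)); exists i; split=> // uj.
  have [y0|y0] := eqVneq (comb w (p \o u)) 0; last first.
    by apply: shortest_conv_hull uw y0 _ iy => // l; rewrite ci.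
  by rewrite -y0; apply: conv_hull_sum => [|l|]; [exact: sw.1|left; exists l|exact: sw.2].
(* The colors missed by [u]; there are exactly [m] since [c \o u] is injective, and [v] lists the
   chosen points [x j] of these colors. *)
pose D := ~: [set c (u k) | k : 'I_d]%SET.
have cardD : m = #|D|.
  by rewrite cardsCs finset.setCK card_imset// !card_ord addKn.
pose v i := x (enum_val (cast_ord cardD i)).
exists u, v; split=> [j|i]; last first.
  apply: (Hx _).2 => l; apply/eqP => ul.
  have := enum_valP (cast_ord cardD i).
  by rewrite inE -ul imset_f.
have [/imsetP[k _ ->]|jD] := boolP (j \in [set c (u k) | k : 'I_d]%SET).
  by exists (u k); rewrite !inE ?imset_f.
have {}jD : j \in D by rewrite inE.
exists (x j); last by rewrite !inE (Hx j).1.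
rewrite inE; apply/orP; right; apply/imsetP.
exists (cast_ord (esym cardD) (enum_rank_in jD j)) => //.
by rewrite /v cast_ordKV enum_rankK_in.
Qed.
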